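(* There exists no smooth function $f:[0,1]\to\mathbb{R}$ which is flat at $x=0$ and satisfies $f^{(n)}(x)>0$ for all $x\in(0,1]$ and all integers $n\geq 0$.
   Context: A smooth function means a function of class $C^\infty$ on the closed interval $[0,1]$ (one-sided derivatives at the endpoints). $f^{(n)}$ denotes the $n$-th derivative, with $f^{(0)}=f$. A smooth function $f$ on $[0,1]$ is flat at $0$ if $f^{(n)}(x)\to 0$ as $x\to 0+0$ for every integer $n\ge 0$ (equivalently, $f^{(n)}(0)=0$ for every $n\geq 0$). *)

(* Defs.v *)
From mathcomp Require Import all_boot all_order all_algebra.
From mathcomp Require Import all_classical all_reals all_analysis.

Set Implicit Arguments.
Unset Strict Implicit.
Unset Printing Implicit Defensive.

Import Order.TTheory GRing.Theory Num.Theory.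
Import numFieldNormedType.Exports.

Local Open Scope classical_set_scope.
Local Open Scope ring_scope.

(* A function [0,1] -> R is represented by a total f : R -> R whose values
   outside [0,1] are ignored: for x in [0,1], every definition below reads f
   at points of [0,1] only. *)

Definition unit_itv (R : realType) : set R := `[0, 1].

Definition diff_quotient (R : realType) (f : R -> R) (x y : R) : R :=
  (f y - f x) / (y - x).

(* Points tending to x inside [0,1], x excluded: the two-sided punctured
   neighbourhoods if 0 < x < 1, the one-sided ones if x = 0 or x = 1. *)
Definition approach (R : realType) (x : R) : set_system R :=
  within (@unit_itv R) x^'.

Definition derivable01 (R : realType) (f : R -> R) (x : R) : Prop :=
  cvg (diff_quotient f x @ approach x).

(* As with derive1, the value is meaningful only under derivable01 f x. *)
Definition derive01 (R : realType) (f : R -> R) (x : R) : R :=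
  lim (diff_quotient f x @ approach x).

Definition derive01n (R : realType) (n : nat) (f : R -> R) : R -> R :=
  iter n (@derive01 R) f.

(* Continuity of each derivative is implied by the existence of the next. *)
Definition smooth01 (R : realType) (f : R -> R) : Prop :=
  forall (n : nat) (x : R), unit_itv x -> derivable01 (derive01n n f) x.

Definition flat0 (R : realType) (f : R -> R) : Prop :=
  forall n : nat, derive01n n f x @[x --> 0^'+] --> (0 : R).

(* Main.v *)
Require Import Defs.
From mathcomp Require Import all_boot all_order all_algebra.
From mathcomp Require Import all_classical all_reals all_analysis.
From mathcomp Require Import ring.

Import Order.TTheory GRing.Theory Num.Theory.
Import numFieldNormedType.Exports.

Local Open Scope ring_scope.

(** Suppose that f is flat at 0 and that all its derivatives are positive on
    ]0, 1].  The point is that f(x) / x^k is then nondecreasing for every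
    natural number k, that is, x f'(x) >= k f(x) on ]0, 1[.  Since f(1/2) is
    positive, the archimedean property makes this absurd at x = 1/2.

    The inequality is proved for f and all its derivatives at once, by
    induction on k.  For k = 0 it says that f' is nonnegative.  For the step,
    g(x) = x f'(x) - (k + 1) f(x) has derivative x f''(x) - k f'(x), which is
    nonnegative by the induction hypothesis applied to f'; so g is
    nondecreasing, and as flatness makes g tend to 0 at 0, g is nonnegative.
    This is [euler_ge_flat], built on [ge0_of_derive_ge0]; it takes the place of
    the estimate of the Taylor remainder in Bernstein's theorem on absolutely
    monotone functions.

    Only interior points are used, where the one-sided derivatives relative to
    [0, 1] are ordinary derivatives ([is_derive_derive01]). *)

(** At an interior point, [0, 1] is a neighbourhood, so restricting the
    difference quotient to it changes nothing. *)
Lemma is_derive_derive01 (R : realType) (f : R -> R) (x : R) :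
  0 < x < 1 -> derivable01 f x -> is_derive x 1 f (derive01 f x).
Proof.
move=> x01 df.
have itvx : \forall y \near x, unit_itv y.
  have xI : x \in `]0, 1[ by rewrite in_itv.
  have := near_in_itvoo xI; apply: filterS => y; rewrite in_itv /= => /andP[? ?].
  by rewrite /unit_itv /= in_itv /= !ltW.
have quot : (h^-1 *: ((f \o shift x) (h *: (1 : R)) - f x) @[h --> 0^'] -->
    derive01 f x)%classic.
  move=> A /df; rewrite /approach /= => dA.
  have : \forall y \near x, (y != x -> unit_itv y -> A (diff_quotient f x y)) /\
      unit_itv y by apply: filterI.
  rewrite (near_shift 0) subr0; apply: filterS => h /= [Ah hx] h0.
  have := Ah _ hx; rewrite /diff_quotient addrK /GRing.scale /= mulr1 mulrC.
  by apply; rewrite -subr_eq0 addrK.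
have dfx : derivable f x 1 by apply/cvg_ex; exists (derive01 f x).
by apply: DeriveDef => //; exact: cvg_lim quot.
Qed.

(** The function g is nondecreasing, so g(x) is an upper bound of the values of
    g closer to 0, hence of their limit. *)
Lemma ge0_of_derive_ge0 (R : realType) (g dg : R -> R) (b : R) :
  (forall x, 0 < x < b -> is_derive x 1 g (dg x)) ->
  (forall x, 0 < x < b -> 0 <= dg x) ->
  (g x @[x --> 0^'+] --> (0 : R))%classic ->
  forall x, 0 < x < b -> 0 <= g x.
Proof.
move=> gd dg0 g0 x /andP[x0 xb].
have D y : y \in `]0, b[ -> derivable g y 1.
  by rewrite in_itv /= => yb; have [] := gd y yb.
apply: (cvgr_to_le g0); near=> y.
have y0 : 0 < y by [].
have yx : y < x by near: y; exact: nbhs_right_lt.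
apply: (@ger0_derive1_le_oo _ g 0 b) => //.
- move=> z zb; rewrite derive1E.
  by move: zb; rewrite in_itv /= => zb; have [_ ->] := gd z zb; exact: dg0.
- move=> z; rewrite inE /= => /D /derivable1_diffP; exact: differentiable_continuous.
- by rewrite in_itv /= y0 (lt_trans yx).
- by rewrite in_itv /= x0.
- exact: ltW.
Unshelve. all: by end_near. Qed.

(** The inequality is an equality for multiples of x^k, and says that [F n]
    divided by x^k is nondecreasing.  It is stated for the
    whole sequence of derivatives because the step from k to k + 1 for [F n]
    needs the inequality at k for [F n.+1]. *)
Lemma euler_ge_flat (R : realType) (F : nat -> R -> R) (b : R) :
  (forall n x, 0 < x < b -> is_derive x 1 (F n) (F n.+1 x)) ->
  (forall n, F n x @[x --> 0^'+] --> (0 : R))%classic ->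
  (forall n x, 0 < x < b -> 0 <= F n x) ->
  forall k n x, 0 < x < b -> k%:R * F n x <= x * F n.+1 x.
Proof.
move=> Fd Fflat F0; elim=> [|k IH] n x xb.
  by rewrite mul0r mulr_ge0 ?F0//; case/andP: xb => /ltW.
rewrite -subr_ge0; move: x xb.
apply: (@ge0_of_derive_ge0 _ _ (fun x => x * F n.+2 x - k%:R * F n.+1 x)).
- move=> x xb; have d0 := Fd n x xb; have d1 := Fd n.+1 x xb.
  apply: is_derive_eq.
  rewrite /GRing.scale /= -natr1; ring.
- by move=> x xb; rewrite subr_ge0 IH.
- rewrite -[X in (_ --> X)%classic](subrr 0).
  apply: cvgB.
    rewrite -[X in (_ --> X)%classic](mul0r 0); apply: cvgM; last exact: Fflat.
    exact: cvg_at_right_filter.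
  rewrite -[X in (_ --> X)%classic](mulr0 k.+1%:R).
  by apply: cvgM; [exact: cvg_cst | exact: Fflat].
Qed.

Theorem theorem1 (R : realType) :
  ~ exists f : R -> R,
      [/\ smooth01 f,
          flat0 f
        & forall (n : nat) (x : R), 0 < x <= 1 -> 0 < derive01n n f x].
Proof.
move=> [f [fsmooth fflat fpos]].
have half01 : 0 < (2^-1 : R) < 1 by rewrite invr_gt0 ltr0n invf_lt1 ?ltr1n.
have ge_half k : k%:R * f 2^-1 <= 2^-1 * derive01 f 2^-1.
  apply: (@euler_ge_flat _ (fun n => derive01n n f) 1 _ _ _ k 0) => //.
  - move=> n x x01; apply: is_derive_derive01 => //.
    by apply: fsmooth; case/andP: x01 => x0 x1; rewrite /unit_itv /= in_itv /= !ltW.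
  - by move=> n x /andP[x0 x1]; rewrite ltW// fpos// x0 ltW.
have fhalf : 0 < f 2^-1 by apply: (fpos 0); case/andP: half01 => -> /ltW.
have df0 : 0 <= 2^-1 * derive01 f 2^-1 / f 2^-1.
  by rewrite divr_ge0 ?(ltW fhalf)//; have := ge_half 0; rewrite mul0r.
by have := archi_boundP df0; rewrite ltr_pdivrMr// ltNge ge_half.
Qed.
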